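(* Let $\Phi=\{f_i\}_{i\in\Lambda}$ be a finite conformal iterated function system on $\mathbb{R}^t$ of the form $f_i(x)=a_iO_ix+b_i$, where $a_i\in(0,1)$, $b_i\in\mathbb{R}^t$ and $O_i$ is a rotation, which satisfies the strong separation condition and has attractor $X$. Write $d=\dim_{\mathrm H}X$. Suppose that there exist $i,j\in\Lambda$ such that $a_i\ne a_j$. Let $\psi\colon\mathbb{N}\to[0,\infty)$ be a monotonic decreasing function such that the limit $$\alpha=\alpha(\psi)=\lim_{n\to\infty}\frac{-\log\psi(n)}{n}$$ exists and satisfies $0<\alpha<d$. Let $s$ be the unique solution of $\sum_{i\in\Lambda}e^{-\alpha s}a_i^s=1$, let $\Psi(\mathbf{i})=\mathrm{diam}(X_{\mathbf{i}})\psi(|\mathbf{i}|)$, and suppose that $\sum_{\mathbf{i}\in\Lambda^*}\Psi(\mathbf{i})^s=\infty$. Then there exists $x\in X$ such that there is no function $\overline{\Psi}\colon\Lambda^*\to[0,\infty)$ of the form $\overline{\Psi}(\mathbf{i})=\mathrm{diam}(X_{\mathbf{i}})\overline{\psi}(|\mathbf{i}|)$, with $\overline{\psi}\colon\mathbb{N}\to[0,\infty)$, satisfying all of the following: (a) $\liminf_{n\to\infty}\frac{-\log\overline{\psi}(n)}{n}\ge0$; (b) $\sum_{\mathbf{i}\in\Lambda^*}\overline{\Psi}(\mathbf{i})^d=\infty$; (c) $W(x,\overline{\Psi}^{\,d/s})\subseteq W(x,\Psi)$.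
   Context: $\mathbb{N}=\{0,1,2,\dots\}$; $\dim_{\mathrm H}$ is Hausdorff dimension. A norm $\|\cdot\|$ on $\mathbb{R}^t$ is fixed; conformality of $\Phi$ with respect to it means here that $\|O_iy\|=\|y\|$ for all $y\in\mathbb{R}^t$, so each $f_i$ is a similarity with ratio $a_i$. The attractor $X$ is the unique non-empty compact set with $X=\bigcup_{i\in\Lambda}f_i(X)$. $\Lambda^*=\bigcup_{n\ge0}\Lambda^n$, $|\mathbf{i}|$ is the length of the word $\mathbf{i}$, $f_{\mathbf{i}}=f_{i_1}\circ\cdots\circ f_{i_{|\mathbf{i}|}}$, $f_\emptyset=\mathrm{id}$, $X_{\mathbf{i}}=f_{\mathbf{i}}(X)$. Strong separation condition: $f_i(X)\cap f_j(X)=\emptyset$ for all $i\neq j$ in $\Lambda$. For a function $\Theta\colon\Lambda^*\to[0,\infty)$, $W(x,\Theta)=\{y\in X:\|y-f_{\mathbf{i}}(x)\|<\Theta(\mathbf{i})\text{ for infinitely many }\mathbf{i}\in\Lambda^*\}$. $\overline{\Psi}^{\,u}$ denotes the function $\mathbf{i}\mapsto\overline{\Psi}(\mathbf{i})^{u}$. Convention: $-\log 0=+\infty$. *)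

(* Defs.v *)
From HB Require Import structures.
From mathcomp Require Import all_boot all_order all_algebra.
From mathcomp Require Import all_classical all_reals all_analysis.
Set Implicit Arguments.
Unset Strict Implicit.
Unset Printing Implicit Defensive.
Import Order.TTheory GRing.Theory Num.Theory.
Import numFieldNormedType.Exports.
Local Open Scope classical_set_scope.
Local Open Scope ring_scope.

(* The norm on R^t is an arbitrary one, hence a parameter [nrm] and not the
   canonical (sup) norm of ['cV[R]_t]; non-negativity follows from the three
   axioms.  Compactness refers to the canonical topology of ['cV[R]_t], which
   is the topology of every norm. *)
Definition is_norm (R : realType) (t : nat) (nrm : 'cV[R]_t -> R) : Prop :=
  [/\ forall x, nrm x = 0 -> x = 0,
      forall (c : R) x, nrm (c *: x) = `|c| * nrm x
    & forall x y, nrm (x + y) <= nrm x + nrm y].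

Definition is_rotation (R : realType) (t : nat) (A : 'M[R]_t) : Prop :=
  A *m A^T = 1%:M /\ \det A = 1.

(* The extra element 0 only matters for the empty set, whose diameter is 0. *)
Definition diam (R : realType) (t : nat) (nrm : 'cV[R]_t -> R)
    (A : set 'cV[R]_t) : \bar R :=
  ereal_sup (0%E |` [set (nrm (x - y))%:E | x in A & y in A]).

(* diam(U)^s, with the conventions diam(set0)^0 = 0 and diam([set x])^0 = 1. *)
Definition diam_pow (R : realType) (t : nat) (nrm : 'cV[R]_t -> R) (s : R)
    (U : set 'cV[R]_t) : \bar R :=
  if U == set0 then 0%E else poweR (diam nrm U) s.

Definition hausdorff_premeasure (R : realType) (t : nat)
    (nrm : 'cV[R]_t -> R) (s delta : R) (A : set 'cV[R]_t) : \bar R :=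
  ereal_inf [set (\sum_(0 <= k <oo) diam_pow nrm s (U k))%E | U in
    [set U : nat -> set 'cV[R]_t |
      A `<=` \bigcup_k U k /\ forall k, (diam nrm (U k) <= delta%:E)%E]].

Definition hausdorff_measure (R : realType) (t : nat)
    (nrm : 'cV[R]_t -> R) (s : R) (A : set 'cV[R]_t) : \bar R :=
  ereal_sup [set hausdorff_premeasure nrm s delta A | delta in
    [set delta : R | 0 < delta]].

Definition hausdorff_dim (R : realType) (t : nat)
    (nrm : 'cV[R]_t -> R) (A : set 'cV[R]_t) : \bar R :=
  ereal_inf [set s%:E | s in
    [set s : R | 0 <= s /\ hausdorff_measure nrm s A = 0%E]].

Definition ifs_map (R : realType) (t : nat) (Lam : finType) (a : Lam -> R)
    (O : Lam -> 'M[R]_t) (b : Lam -> 'cV[R]_t) (i : Lam) (x : 'cV[R]_t) :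
    'cV[R]_t :=
  a i *: (O i *m x) + b i.

Definition is_attractor (R : realType) (t : nat) (Lam : finType)
    (f : Lam -> 'cV[R]_t -> 'cV[R]_t) (X : set 'cV[R]_t) : Prop :=
  [/\ X !=set0, compact X & X = \bigcup_i (f i @` X)].

Definition strong_separation (R : realType) (t : nat) (Lam : finType)
    (f : Lam -> 'cV[R]_t -> 'cV[R]_t) (X : set 'cV[R]_t) : Prop :=
  forall i j : Lam, i != j -> f i @` X `&` f j @` X = set0.

Definition word_map (R : realType) (t : nat) (Lam : finType)
    (f : Lam -> 'cV[R]_t -> 'cV[R]_t) (w : seq Lam) (x : 'cV[R]_t) :
    'cV[R]_t :=
  foldr f x w.

(* The function w |-> diam(X_w) psi(|w|); X is bounded whenever this is used,
   so that the diameter is finite. *)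
Definition diam_scaled (R : realType) (t : nat) (nrm : 'cV[R]_t -> R)
    (Lam : finType) (f : Lam -> 'cV[R]_t -> 'cV[R]_t) (X : set 'cV[R]_t)
    (psi : nat -> R) (w : seq Lam) : R :=
  fine (diam nrm (word_map f w @` X)) * psi (size w).

Definition limsup_set (R : realType) (t : nat) (nrm : 'cV[R]_t -> R)
    (Lam : finType) (f : Lam -> 'cV[R]_t -> 'cV[R]_t) (X : set 'cV[R]_t)
    (x : 'cV[R]_t) (Theta : seq Lam -> R) : set 'cV[R]_t :=
  [set y | X y /\
    infinite_set [set w : seq Lam | nrm (y - word_map f w x) < Theta w]].

(* The sequence (- log psi(n)) / n in the extended reals; [lne 0 = -oo]
   implements - log 0 = +oo.  The value at n = 0 is irrelevant, as only
   limits are taken. *)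
Definition decay_rate (R : realType) (psi : nat -> R) (n : nat) : \bar R :=
  (- lne (psi n)%:E * (n%:R^-1)%:E)%E.

(* Main.v *)
(** Let [l <> j] be two letters, [j] chosen so that [exp (- alpha) <
   a_j ^ (d / s - 1)], and let [x] be the point coded by [l l j j j ...].  Such
   a [j] exists because [a_i ^ d] and [exp (- alpha s) a_i ^ s] are two distinct
   probability vectors; that the first one is a probability vector is the
   Moran-Hutchinson formula for [d].  Divergence (b) makes [psib n] at least
   [exp (- eps n)] for infinitely many [n], so the ball of radius
   [Psib w ^ (d / s)] at [f_w x] is exponentially larger than the one of radius
   [Psi w] whenever [w] is a fixed word followed by many [j]'s and [|w|] is such
   an [n].  Hence there is [y], coded by a concatenation of blocks
   [j^p l l j^m l j] with sparse positions, which approaches the orbit of [x]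
   at the scale [Psib ^ (d / s)] once in each block, but never (up to finitely
   many words) at the scale [Psi]: after [m] letters the match with
   [l l j j j ...] is deliberately broken by the next [l]. *)
Require Import Defs.
From HB Require Import structures.
From mathcomp Require Import all_boot all_order all_algebra.
From mathcomp Require Import all_classical all_reals all_analysis.
From mathcomp Require Import ring lra zify.
Set Implicit Arguments.
Unset Strict Implicit.
Unset Printing Implicit Defensive.
Import Order.TTheory GRing.Theory Num.Theory.
Import numFieldNormedType.Exports.
Local Open Scope classical_set_scope.
Local Open Scope ring_scope.

(** * Arbitrary norms on R^t and their continuity for the canonical topology *)

Section VectorNorm.
Variables (R : realType) (t : nat) (nrm : 'cV[R]_t -> R).
Hypothesis nrm_norm : is_norm nrm.

Lemma is_norm0 : nrm 0 = 0.
Proof.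
by case: nrm_norm => _ nrmZ _; rewrite -[0](scale0r 0) nrmZ normr0 mul0r.
Qed.

Lemma is_normN x : nrm (- x) = nrm x.
Proof.
by case: nrm_norm => _ nrmZ _; rewrite -scaleN1r nrmZ normrN1 mul1r.
Qed.

Lemma is_norm_distC x y : nrm (x - y) = nrm (y - x).
Proof. by rewrite -is_normN opprB. Qed.

Lemma is_norm_ge0 x : 0 <= nrm x.
Proof.
case: nrm_norm => _ _ /(_ x (- x)); rewrite subrr is_norm0 is_normN; lra.
Qed.

Lemma is_norm_gt0 x : x != 0 -> 0 < nrm x.
Proof.
move=> x0; rewrite lt_neqAle is_norm_ge0 andbT eq_sym.
by case: nrm_norm => nrm_eq0 _ _; apply: contra_neq x0 => /nrm_eq0.
Qed.

Lemma is_norm_sum (I : Type) (r : seq I) (F : I -> 'cV[R]_t) :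
  nrm (\sum_(i <- r) F i) <= \sum_(i <- r) nrm (F i).
Proof.
elim: r => [|i r IH]; first by rewrite !big_nil is_norm0.
rewrite !big_cons; case: nrm_norm => _ _ /(_ (F i) (\sum_(j <- r) F j)) nrmD.
lra.
Qed.

Lemma is_norm_le_coord x : nrm x <= \sum_i `|x i 0| * nrm (delta_mx i 0).
Proof.
rewrite [X in nrm X](matrix_sum_delta x).
apply: le_trans (is_norm_sum _ _) _; apply: ler_sum => i _.
rewrite big_ord1; case: nrm_norm => _ nrmZ _; by rewrite nrmZ ord1.
Qed.

Lemma is_norm_dist_dist x y : `|nrm x - nrm y| <= nrm (x - y).
Proof.
case: nrm_norm => _ _ nrmD.
have := nrmD (x - y) y; have := nrmD (y - x) x.
by rewrite !subrK (is_norm_distC y x) ler_norml => ? ?; apply/andP; split; lra.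
Qed.

(** By the reverse triangle inequality and expansion in the canonical basis, [nrm] is Lipschitz in
    the coordinates, with constant the sum [C] of the norms of the basis vectors. *)
Lemma is_norm_continuous : continuous nrm.
Proof.
move=> x.
pose C := \sum_i nrm (delta_mx i 0).
have C0 : 0 <= C by apply: sumr_ge0 => i _; exact: is_norm_ge0.
apply/(@cvgrPdist_le _ R^o _ _ (nbhs_filter x)) => e e0.
change (\forall y \near x, `|nrm x - nrm y| <= e).
(* [C + 1] replaces [C], which vanishes when [t = 0]. *)
exists (fun i j => ball (x i j) (e / (C + 1))).
  by move=> i j; apply: nbhsx_ballx; apply: divr_gt0 => //; lra.
move=> /= y xy; apply: le_trans (is_norm_dist_dist _ _) _.
apply: le_trans (is_norm_le_coord _) _.
apply: (@le_trans _ _ (\sum_i (e / (C + 1)) * nrm (delta_mx i 0))).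
  apply: ler_sum => i _; apply: ler_wpM2r; first exact: is_norm_ge0.
  rewrite !mxE; apply: ltW; exact: (xy i 0).
rewrite -mulr_sumr -/C mulrAC ler_pdivrMr; last by lra.
by rewrite ler_pM2l//; lra.
Qed.

End VectorNorm.

(** * Continuity of affine maps, coordinate by coordinate *)

Section MatrixContinuity.
Variable R : realType.

Lemma continuous_mx (T : topologicalType) m n (f : T -> 'M[R]_(m, n)) :
  (forall i j, continuous (fun x => f x i j)) -> continuous f.
Proof.
move=> fC x A [P fxP PA].
rewrite /nbhs /=.
have : \forall y \near x, forall i j, P i j (f y i j).
  by apply: filter_forall => i; apply: filter_forall => j; exact: fC.
by apply: filterS => y; exact: PA.
Qed.

Lemma continuous_affine_mx m n (A : 'M[R]_(m, n)) (c : R) (b : 'cV[R]_m) :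
  continuous (fun x : 'cV[R]_n => c *: (A *m x) + b).
Proof.
apply: continuous_mx => i j.
pose T := 'cV[R]_n.
rewrite (_ : (fun _ => _) =
    (fun x : T => c * (\sum_k A i k * x k j) + b i j)); last first.
  by apply/funext => x; rewrite !mxE.
move=> x.
have K (r : R) : {for x, continuous ((fun=> r) : T -> R)}.
  exact: (@cst_continuous T R r x).
apply: (@continuousD _ _ T (fun y : T => c * (\sum_k A i k * y k j))
  (fun=> b i j)) => //.
apply: (@continuousM _ T (fun=> c) (fun y : T => \sum_k A i k * y k j)) => //.
elim: (index_enum _) => [|k r IH].
  rewrite (_ : (fun _ => _) = (fun=> 0)); first exact: K.
  by apply/funext => y; rewrite big_nil.
rewrite (_ : (fun _ => _) =
    (fun y : T => A i k * y k j + \sum_(k <- r) A i k * y k j)); last first.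
  by apply/funext => y; rewrite big_cons.
apply: (@continuousD _ _ T (fun y : T => A i k * y k j) _ x _ IH).
apply: (@continuousM _ T (fun=> A i k) (fun y : T => y k j)) => //.
exact: coord_continuous.
Qed.

End MatrixContinuity.

(** * Finite words, product weights, and avoidance of a sequence of light words *)

Section Words.
Variables (R : realType) (Lam : finType).
Implicit Types (p : Lam -> R) (w : seq Lam).

Fixpoint words n : seq (seq Lam) :=
  if n is m.+1 then [seq i :: w | i <- index_enum Lam, w <- words m]
  else [:: [::]].

Lemma mem_words w : w \in words (size w).
Proof.
elim: w => [//|i w IH]; apply/allpairsP; exists (i, w); split => //=.
exact: mem_index_enum.
Qed.

Lemma size_words n w : w \in words n -> size w = n.
Proof.
elim: n w => [|n IH] w; first by rewrite inE => /eqP ->.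
by move=> /allpairsP[[i v] /= [_ /IH <- ->]].
Qed.

Lemma sum_words p n : \sum_(w <- words n) \prod_(i <- w) p i = (\sum_i p i) ^+ n.
Proof.
elim: n => [|n IH]; first by rewrite big_seq1 big_nil.
rewrite exprS -IH [words _]/= big_allpairs_dep mulr_suml.
apply: eq_bigr => i _; rewrite mulr_sumr; apply: eq_bigr => w _.
by rewrite big_cons.
Qed.

Lemma finite_words_lt n : finite_set [set w : seq Lam | (size w < n)%N].
Proof.
apply: (@sub_finite_set _ _ [set` flatten [seq words m | m <- iota 0 n]]).
  move=> w /= wn; apply/flattenP; exists (words (size w)); last exact: mem_words.
  by apply/mapP; exists (size w); rewrite // mem_iota.
exact: finite_seq.
Qed.

Lemma infinite_words (A : set (seq Lam)) :
  (forall n, exists2 w, A w & (n <= size w)%N) -> infinite_set A.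
Proof.
move=> Alarge /finite_seqP[s As].
have [w Aw sw] := Alarge (\max_(v <- s) size v).+1.
have ws : w \in s by move: Aw; rewrite As.
by move: sw; rewrite (big_rem w)//= ltnNge leq_maxl.
Qed.

Lemma ler_sum_uniq_sub (T : eqType) (F : T -> R) (s r : seq T) :
  (forall x, 0 <= F x) -> uniq s -> {subset s <= r} ->
  \sum_(x <- s) F x <= \sum_(x <- r) F x.
Proof.
move=> F0; elim: s r => [|x s IH] r /=; first by rewrite big_nil sumr_ge0.
move=> /andP[xs us] sr; have xr : x \in r by rewrite sr ?mem_head.
rewrite big_cons (perm_big _ (perm_to_rem xr)) big_cons lerD2l; apply: IH => //.
move=> y ys; have : y \in r by rewrite sr// inE ys orbT.
rewrite (perm_mem (perm_to_rem xr)) inE => /predU1P[yx|//].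
by rewrite -yx ys in xs.
Qed.

(* The invariant of the greedy choice of letters: the words [W k] extending
   the prefix already built weigh less than this prefix. *)
Lemma exists_avoiding p (W : nat -> seq Lam) : (forall i, 0 <= p i) ->
  1 <= \sum_i p i ->
  (\sum_(0 <= k <oo) (\prod_(i <- W k) p i)%:E < 1)%E ->
  exists om : nat -> Lam, forall n k, mkseq om n <> W k.
Proof.
move=> p0 p1 W1.
pose P w := \prod_(i <- w) p i.
have P0 w : 0 <= P w by apply: prodr_ge0.
pose T v k : \bar R := if prefix v (W k) then (P (W k))%:E else 0%E.
have T0 v k : (0 <= T v k)%E by rewrite /T; case: ifP; rewrite ?lee_fin.
pose S v : \bar R := (\sum_(0 <= k <oo) T v k)%E.
have [i0 _] : exists i0 : Lam, true.
  case: (pickP (xpredT : pred Lam)) => [i _|none]; first by exists i.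
  by move: p1; rewrite big_pred0// ler10.
have step v : exists i, (S v < (P v)%:E)%E -> (S (rcons v i) < (P (rcons v i))%:E)%E.
  have [Sv|Sv] := boolP (S v < (P v)%:E)%E; last by exists i0.
  (* If [P <= S] held at every child of [v], summing over the letters would give it at [v]: the
     children weigh at least [P v] in all, and each [W k] extends at most one of them. *)
  apply: contrapT => /forallNP noi; move: Sv; rewrite ltNge => /negP; apply.
  have noi' i : ((P (rcons v i))%:E <= S (rcons v i))%E.
    by rewrite leNgt; apply/negP => h; exact: (noi i).
  apply: (@le_trans _ _ (\sum_i S (rcons v i))%E).
    apply: (@le_trans _ _ (\sum_i (P (rcons v i))%:E)%E); last exact: lee_sum.
    rewrite sumEFin lee_fin.
    under eq_bigr => i _ do rewrite /P -cats1 big_cat big_seq1 /=.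
    by rewrite -mulr_sumr ler_peMr.
  rewrite -nneseries_sum//; apply: lee_nneseries => [k _ _|k _].
    by apply: sume_ge0.
  rewrite /T; case: (boolP (prefix v (W k))) => [/prefixP[u Wu]|nv]; last first.
    rewrite big1// => i _; case: ifP => // h; case/negP: nv.
    by move: h; rewrite -cats1 => /catl_prefix.
  case: u Wu => [|j u] Wu.
    rewrite big1 ?lee_fin// => i _; case: ifP => // /size_prefix.
    by rewrite Wu cats0 size_rcons ltnn.
  rewrite (bigD1 j)//= big1 ?adde0; last first.
    by move=> i ij; rewrite Wu -cats1 prefix_catr// eqxx /= (negbTE ij).
  by case: ifP; rewrite ?lee_fin.
have [F FE] := choice step.
pose v n := iter n (fun v => rcons v (F v)) [::].
have Sv n : (S (v n) < (P (v n))%:E)%E.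
  elim: n => [|n]; last exact: FE.
  rewrite /P /v /= big_nil; apply: le_lt_trans W1; apply: lee_nneseries => // k _.
  by rewrite /T prefix0s.
exists (fun n => F (v n)) => n k.
have -> : mkseq (fun n => F (v n)) n = v n.
  by elim: n => //= n IH; rewrite mkseqS IH.
(* A word [W k] equal to the prefix would alone contribute [P (v n)] to [S (v n)]. *)
move=> vW; have := Sv n; rewrite ltNge vW => /negP; apply.
rewrite /S (nneseriesD1 (n := k))// {1}/T prefix_refl.
by rewrite leeDl// nneseries_ge0.
Qed.

Lemma exp_near_le (r c : R) : 0 <= r < 1 -> 0 < c ->
  exists N, forall n, (N <= n)%N -> r ^+ n <= c.
Proof.
move=> /andP[r0 r1] c0.
have r1' : `|r| < 1 by rewrite ger0_norm.
have /cvgrPdist_le /(_ c c0) [N _ NP] := cvg_expr r1'.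
exists N => n Nn; have := NP n Nn.
by rewrite /= sub0r normrN ger0_norm// exprn_ge0.
Qed.

Lemma continuous_sum_powR (b : Lam -> R) (d : R) : (forall i, 0 < b i) ->
  {for d, continuous (fun x => \sum_i b i `^ x)}.
Proof.
move=> b0.
elim: (index_enum Lam) => [|k r IH].
  rewrite (_ : (fun _ => _) = (fun=> 0)); first exact: cst_continuous.
  by apply/funext => y; rewrite big_nil.
rewrite (_ : (fun _ => _) =
    (fun y => expR (y * ln (b k)) + \sum_(k <- r) b k `^ y)); last first.
  by apply/funext => y; rewrite big_cons /powR gt_eqF.
apply: (@continuousD _ _ R (fun y => expR (y * ln (b k))) _ d _ IH).
apply: (@continuous_comp R R R (fun y => y * ln (b k)) expR d).
  exact: mulrr_continuous.
exact: continuous_expR.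
Qed.

End Words.

(** * Exponential estimates and the choice of the letter [j] *)

Lemma exp_sandwich (R : realType) (A v : R) : 0 < A < 1 -> 0 < v <= A ->
  exists m, [/\ (0 < m)%N, v <= A ^+ m & A ^+ m * A < v].
Proof.
move=> /andP[A0 A1] /andP[v0 vA].
have exn : exists n, A ^+ n < v.
  have A01 : 0 <= A < 1 by rewrite ltW.
  have [N /(_ N (leqnn N)) NP] := exp_near_le A01 (divr_gt0 v0 (@ltr0Sn R 1)).
  by exists N; lra.
(* The least exponent [n] with [A ^+ n < v] is at least 2, because [v <= A < 1]; the witness is its
   predecessor. *)
case: (ex_minnP exn) => -[|[|m]]; rewrite ?expr0 ?expr1 => An minA; [lra|lra|].
exists m.+1; split => //; last by rewrite -exprSr.
by rewrite leNgt; apply/negP => /minA; rewrite ltnn.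
Qed.

Lemma decay_rate_gt (R : realType) (psi : nat -> R) (alpha beta : R) :
  (forall n, 0 <= psi n) -> decay_rate psi n @[n --> \oo] --> alpha%:E ->
  beta < alpha -> exists N, forall n, (N <= n)%N -> psi n <= expR (- beta) ^+ n.
Proof.
move=> psi0 lim ba.
have [N _ NP] := lim _ (@nbhs_open_ereal_gt R alpha (fun=> beta) ba).
(* The shift to [N.+1] keeps [n] positive, so that the division by [n] in [decay_rate] can be
   undone. *)
exists N.+1 => n Nn; have /NP /= : (N <= n)%N by exact: ltnW.
have [->|psin _] := eqVneq (psi n) 0; first by rewrite exprn_ge0// expR_ge0.
have {psin} : 0 < psi n by rewrite lt_neqAle eq_sym psin psi0.
move=> psin0; have n0 : 0 < n%:R :> R by rewrite ltr0n; case: n Nn {psin0}.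
have := NP n (ltnW Nn).
rewrite /= /decay_rate lne_EFin// -EFinN -EFinM lte_fin ltr_pdivlMr// => lnpsi.
rewrite -expRM_natr -(lnK psin0) ler_expR mulNr; lra.
Qed.

(** If every [j] failed, then [exp (- alpha s) a_i ^ s >= a_i ^ d] for each [i]; both sides have sum
    1, so they agree termwise, which forces [ln a_i = - alpha s / (d - s)] for all [i], against the
    existence of two distinct ratios. *)
Lemma exists_frequency_gap (R : realType) (Lam : finType) (a : Lam -> R)
    (alpha s d : R) : (forall i, 0 < a i < 1) -> (exists i j, a i <> a j) ->
  0 < alpha -> \sum_i a i `^ d = 1 ->
  \sum_i expR (- (alpha * s)) * (a i `^ s) = 1 ->
  0 < s < d /\ exists j, expR (- alpha) < a j `^ (d / s - 1).
Proof.
move=> a_itv [k [l akl]] alpha0 sumd sums.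
have a0 i : 0 < a i by case/andP: (a_itv i).
have powRE i x : a i `^ x = expR (x * ln (a i)) by rewrite /powR gt_eqF.
have s0 : 0 < s.
  (* For [s <= 0] every summand is at least 1, and there are at least two letters. *)
  rewrite ltNge; apply/negP => s0; have kl : k != l by apply/eqP => kl; rewrite kl in akl.
  have term i : 1 <= expR (- (alpha * s)) * (a i `^ s).
    have e1 : 1 <= expR (- (alpha * s)).
      by rewrite -expR0 ler_expR oppr_ge0 mulr_ge0_le0// ltW.
    have as1 : 1 <= a i `^ s.
      rewrite -(powRr0 (a i)); apply: ger_powR => //.
      by case/andP: (a_itv i) => -> /ltW ->.
    by rewrite -[leLHS]mulr1 ler_pM.
  move: sums; rewrite (bigD1 k)//= (bigD1 l) 1?eq_sym//= => sums.
  have := term k; have := term l.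
  have : 0 <= \sum_(i | (i != k) && (i != l)) expR (- (alpha * s)) * (a i `^ s).
    by apply: sumr_ge0 => i _; rewrite mulr_ge0 ?expR_ge0 ?powR_ge0.
  lra.
have sd : s < d.
  (* For [s >= d] the sum is at most [exp (- alpha s) < 1]. *)
  rewrite ltNge; apply/negP => ds.
  have : \sum_i expR (- (alpha * s)) * (a i `^ s) <= expR (- (alpha * s)).
    rewrite -mulr_sumr ler_piMr ?expR_ge0// -sumd; apply: ler_sum => i _.
    by apply: ger_powR => //; case/andP: (a_itv i) => -> /ltW ->.
  rewrite sums; apply/negP; rewrite -ltNge -expR0 ltr_expR oppr_lt0.
  exact: mulr_gt0.
split; first by rewrite s0.
apply: contrapT => /forallNP noj.
have lnle i : (d - s) * ln (a i) <= - (alpha * s).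
  have : ~~ (expR (- alpha) < a i `^ (d / s - 1)) by apply/negP; exact: noj.
  rewrite -leNgt powRE ler_expR => h.
  have := ler_wpM2l (ltW s0) h.
  by rewrite mulrA mulrBr mulr1 mulrCA divff ?gt_eqF// mulr1 mulrN (mulrC s alpha).
have term_ge0 i : 0 <= expR (- (alpha * s)) * (a i `^ s) - a i `^ d.
  rewrite subr_ge0 !powRE -expRD ler_expR; have := lnle i; lra.
have : \sum_i (expR (- (alpha * s)) * (a i `^ s) - a i `^ d) = 0.
  by rewrite sumrB sums sumd subrr.
move/(psumr_eq0P (fun i _ => term_ge0 i)) => eq0.
apply: akl; apply: ln_inj; rewrite ?posrE//.
have lnE i : (d - s) * ln (a i) = - (alpha * s).
  have /eqP := eq0 i isT; rewrite subr_eq0 !powRE -expRD => /eqP/expR_inj.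
  lra.
have ds0 : d - s != 0 by rewrite subr_eq0 gt_eqF.
by apply: (mulfI ds0); rewrite !lnE.
Qed.

(** * Combinatorics of the blocks that make up the code of [y] *)

Section Blocks.
Variables (T : eqType) (j l : T).

(** The code of the centre [x]. *)
Definition llj (q : nat) : T := if (q < 2)%N then l else j.

(** After [j^p], the letters [l l j^m] follow the code of [x] and the next [l] breaks off; the final
    [j] makes the match starting at that last [l] fail inside the same block. *)
Definition block p m : seq T := nseq p j ++ l :: l :: nseq m j ++ [:: l; j].

Lemma mkseq_llj m : mkseq llj m.+2 = l :: l :: nseq m j.
Proof.
apply: (@eq_from_nth _ j); first by rewrite size_mkseq /= size_nseq.
move=> i; rewrite size_mkseq => im; rewrite nth_mkseq//.
by case: i im => [|[|i]] //= _; rewrite nth_nseq if_same.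
Qed.

Lemma size_block p m : size (block p m) = (p + m + 4)%N.
Proof. by rewrite size_cat /= size_cat !size_nseq /=; lia. Qed.

Lemma nth_block p m i : nth j (block p m) i =
  if [|| i == p, i == p.+1 | i == (p + m).+2] then l else j.
Proof.
rewrite /block nth_cat size_nseq; case: ltnP => ip.
  rewrite nth_nseq ip; case: ifP => //; lia.
case E: (i - p)%N => [|[|k]] /=.
- by rewrite ifT//; lia.
- by rewrite ifT//; lia.
rewrite nth_cat size_nseq; case: ltnP => km.
  rewrite nth_nseq km; case: ifP => //; lia.
case F: (k - m)%N => [|[|k']] /=.
- by rewrite ifT//; lia.
- by case: ifP => //; lia.
- by rewrite nth_nil; case: ifP => //; lia.
Qed.

(* [q] is where the block read from position [i] departs from [l l j j j ...];
   the second alternative is the intended close approach. *)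
Lemma block_mismatch p m i : j != l -> (0 < m)%N -> (i < p + m + 4)%N ->
  exists q, [/\ (i + q < p + m + 4)%N, nth j (block p m) (i + q) <> llj q
    & (q <= 1)%N \/ i = p /\ q = m.+2].
Proof.
move=> jl m0 im.
have [ip|ip] := eqVneq i p.
  exists m.+2; split; [lia| |by right]; rewrite nth_block ifT; last lia.
  by rewrite /llj /=; move/eqP/nesym: jl.
(* After the second and the third [l] comes a [j], by [0 < m] and by the final [j]; all remaining
   positions carry [j], which differs from the leading [l] at once. *)
have [i1|i1] := boolP ((i == p.+1) || (i == (p + m).+2)).
  exists 1%N; split; [lia| |by left]; rewrite nth_block ifF; last lia.
  exact/eqP.
exists 0%N; split; [lia| |by left]; rewrite addn0 nth_block ifF.
  exact/eqP.
lia.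
Qed.

End Blocks.

(** Members of the chain agree on common positions, and [u n.+1] has more than [n] letters, so the
    diagonal never reads the default [x0]. *)
Lemma nth_prefix_chain (T : Type) (x0 : T) (u : nat -> seq T) :
  (forall k, exists v, u k.+1 = u k ++ v) -> (forall k, (k <= size (u k))%N) ->
  forall k, mkseq (fun n => nth x0 (u n.+1) n) (size (u k)) = u k.
Proof.
move=> chain usize.
have chainD k e : exists v, u (k + e)%N = u k ++ v.
  elim: e => [|e [v uv]]; first by exists [::]; rewrite addn0 cats0.
  by rewrite addnS; have [v' ->] := chain (k + e)%N; exists (v ++ v'); rewrite uv catA.
have nthE k k' n : (k <= k')%N -> (n < size (u k))%N ->
    nth x0 (u k') n = nth x0 (u k) n.
  move=> kk' nk; rewrite -(subnKC kk'); have [v ->] := chainD k (k' - k)%N.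
  by rewrite nth_cat nk.
move=> k; apply: (@eq_from_nth _ x0); rewrite size_mkseq// => n nk.
rewrite nth_mkseq//; have [kn|nk'] := leqP k n.+1; first exact: nthE.
by rewrite -(nthE n.+1 k)//; exact: ltnW.
Qed.

(** * Diameters and Hausdorff premeasures *)

Section Diameter.
Variables (R : realType) (t : nat) (nrm : 'cV[R]_t -> R).
Implicit Types (A U : set 'cV[R]_t).

Lemma diam_ge0 A : (0 <= diam nrm A)%E.
Proof. by apply: ereal_sup_ubound; left. Qed.

Lemma diam_ge A x y : A x -> A y -> ((nrm (x - y))%:E <= diam nrm A)%E.
Proof. by move=> Ax Ay; apply: ereal_sup_ubound; right; exists x => //; exists y. Qed.

Lemma diam_le A (M : R) : 0 <= M -> (forall x y, A x -> A y -> nrm (x - y) <= M) ->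
  (diam nrm A <= M%:E)%E.
Proof.
move=> M0 AM; apply: ge_ereal_sup => _ [->|[x Ax [y Ay <-]]].
  by rewrite lee_fin.
by rewrite lee_fin AM.
Qed.

Lemma diam_pow_ge0 s U : (0 <= diam_pow nrm s U)%E.
Proof. by rewrite /diam_pow; case: ifP => // _; exact: poweR_ge0. Qed.

Lemma diam_pow0 s : diam_pow nrm s set0 = 0%E.
Proof. by rewrite /diam_pow eqxx. Qed.

Lemma hausdorff_premeasure_ge0 s delta A :
  (0 <= hausdorff_premeasure nrm s delta A)%E.
Proof.
apply: le_ereal_inf_tmp => _ [U _ <-]; apply: nneseries_ge0 => k _ _.
exact: diam_pow_ge0.
Qed.

Lemma hausdorff_premeasure_le s delta A : 0 < delta ->
  (hausdorff_premeasure nrm s delta A <= hausdorff_measure nrm s A)%E.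
Proof. by move=> d0; apply: ereal_sup_ubound; exists delta. Qed.

End Diameter.

(** * Cylinders and codes of points of the attractor *)

Section SelfSimilar.
Variables (R : realType) (t : nat) (nrm : 'cV[R]_t -> R).
Hypothesis nrm_norm : is_norm nrm.
Variables (Lam : finType) (a : Lam -> R) (f : Lam -> 'cV[R]_t -> 'cV[R]_t).
Variable X : set 'cV[R]_t.
Hypothesis a_itv : forall i, 0 < a i < 1.
Hypothesis f_continuous : forall i, continuous (f i).
Hypothesis f_sim : forall i x y, nrm (f i x - f i y) = a i * nrm (x - y).
Hypothesis X_attractor : is_attractor f X.
Hypothesis ssc : strong_separation f X.

Definition wratio (w : seq Lam) : R := \prod_(i <- w) a i.

Definition cylinder (w : seq Lam) : set 'cV[R]_t := word_map f w @` X.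

Definition codes (om : nat -> Lam) (y : 'cV[R]_t) : Prop :=
  forall n, cylinder (mkseq om n) y.

Lemma wratio_cons i w : wratio (i :: w) = a i * wratio w.
Proof. exact: big_cons. Qed.

Lemma wratio_cat v w : wratio (v ++ w) = wratio v * wratio w.
Proof. exact: big_cat. Qed.

Lemma wratio_nseq n i : wratio (nseq n i) = a i ^+ n.
Proof. by rewrite /wratio big_nseq iter_mulr_1. Qed.

Lemma wratio_gt0 w : 0 < wratio w.
Proof. by apply: prodr_gt0 => i _; case/andP: (a_itv i). Qed.

Lemma wratio_le1 w : wratio w <= 1.
Proof.
elim: w => [|i w IH]; first by rewrite /wratio big_nil.
rewrite wratio_cons; have /andP[? ?] := a_itv i.
by rewrite mulr_ile1 //; apply: ltW => //; exact: wratio_gt0.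
Qed.

Lemma wratio_le_pow M w : (forall i, a i <= M) -> wratio w <= M ^+ size w.
Proof.
move=> aM; elim: w => [|i w IH]; first by rewrite /wratio big_nil.
rewrite wratio_cons exprS ler_pM//; first by case/andP: (a_itv i) => /ltW.
exact: ltW (wratio_gt0 _).
Qed.

Lemma mkseqS_shift (om : nat -> Lam) n :
  mkseq om n.+1 = om 0%N :: mkseq (om \o S) n.
Proof. by rewrite /mkseq /= (iotaDl 1 0) -map_comp. Qed.

Lemma attractor_sub i x : X x -> X (f i x).
Proof. by case: X_attractor => _ _ {2}-> Xx; exists i => //; exists x. Qed.

Lemma attractor_preimage x : X x ->
  exists p : Lam * 'cV[R]_t, X p.2 /\ x = f p.1 p.2.
Proof.
case: X_attractor => _ _ {1}-> [i _ [z Xz <-]].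
by exists (i, z).
Qed.

Lemma word_map_sub w x : X x -> X (word_map f w x).
Proof. by move=> Xx; elim: w => //= i w; exact: attractor_sub. Qed.

Lemma cylinder_sub w : cylinder w `<=` X.
Proof. by move=> _ [x Xx <-]; exact: word_map_sub. Qed.

Lemma word_map_cat v w x : word_map f (v ++ w) x = word_map f v (word_map f w x).
Proof. exact: foldr_cat. Qed.

Lemma cylinder_cat v w : cylinder (v ++ w) `<=` cylinder v.
Proof.
move=> _ [x Xx <-]; exists (word_map f w x); first exact: word_map_sub.
by rewrite word_map_cat.
Qed.

Lemma word_map_sim w x y :
  nrm (word_map f w x - word_map f w y) = wratio w * nrm (x - y).
Proof.
elim: w => [|i w IH] /=; first by rewrite /wratio big_nil mul1r.
by rewrite f_sim IH wratio_cons mulrA.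
Qed.

Lemma sim_inj i : injective (f i).
Proof.
move=> x y /eqP; rewrite -subr_eq0 => /eqP fxy.
have := f_sim i x y; rewrite fxy (is_norm0 nrm_norm) => /esym /eqP.
rewrite mulf_eq0; have /andP[ai0 _] := a_itv i; rewrite (gt_eqF ai0) /=.
case: nrm_norm => nrm_eq0 _ _ /eqP /nrm_eq0 /eqP.
by rewrite subr_eq0 => /eqP.
Qed.

Lemma word_map_continuous w : continuous (word_map f w).
Proof.
elim: w => [|i w IH] x; first exact: cvg_id.
by apply: (@continuous_comp _ _ _ (word_map f w) (f i) x (IH x)); exact: f_continuous.
Qed.

Lemma cylinder_closed w : closed (cylinder w).
Proof.
apply: compact_closed; first exact: norm_hausdorff.
apply: continuous_compact; last by case: X_attractor.
by apply: continuous_subspaceT; exact: word_map_continuous.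
Qed.

Lemma bounded_attractor : exists2 M, 0 <= M &
  forall x y, X x -> X y -> nrm (x - y) <= M.
Proof.
case: X_attractor => X0 Xc _.
have [z _ zM] := compact_EVT_max X0 Xc
  (continuous_subspaceT (is_norm_continuous nrm_norm)).
exists (nrm z + nrm z); first by rewrite addr_ge0 ?(is_norm_ge0 nrm_norm).
move=> x y /mem_set Xx /mem_set Xy; case: nrm_norm => _ _ nrmD.
rewrite (le_trans (nrmD _ _))// (is_normN nrm_norm).
by apply: lerD; exact: zM.
Qed.

Lemma diam_attractor_fin : diam nrm X = (fine (diam nrm X))%:E.
Proof.
have [M M0 XM] := bounded_attractor.
rewrite fineK// ge0_fin_numE ?diam_ge0//.
by rewrite (le_lt_trans (diam_le M0 XM))// ltry.
Qed.

Lemma diam_cylinder w :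
  diam nrm (cylinder w) = (wratio w * fine (diam nrm X))%:E.
Proof.
have rw := wratio_gt0 w.
have D0 : 0 <= fine (diam nrm X) by rewrite fine_ge0 ?diam_ge0.
have le : (diam nrm (cylinder w) <= (wratio w * fine (diam nrm X))%:E)%E.
  apply: diam_le; first by rewrite mulr_ge0 // ltW.
  move=> _ _ [x Xx <-] [y Xy <-]; rewrite word_map_sim ler_pM2l//.
  by rewrite -lee_fin -diam_attractor_fin; exact: diam_ge.
apply/eqP; rewrite eq_le le /=.
have fin : diam nrm (cylinder w) \is a fin_num.
  by rewrite ge0_fin_numE ?diam_ge0// (le_lt_trans le)// ltry.
rewrite -(fineK fin) lee_fin mulrC -ler_pdivlMr// -lee_fin.
rewrite -diam_attractor_fin; apply: diam_le.
  by rewrite divr_ge0 ?(ltW rw)// fine_ge0 ?diam_ge0.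
move=> x y Xx Xy; rewrite ler_pdivlMr// mulrC -word_map_sim -lee_fin fineK//.
by apply: diam_ge; [exists x|exists y].
Qed.

(** For two distinct letters the distance attains its minimum on the compact product of [X] with
    itself, and strong separation makes it positive; there are finitely many pairs. *)
Lemma separation_gap : exists2 g, 0 < g <= 1 &
  forall i j x y, i != j -> X x -> X y -> g <= nrm (f i x - f j y).
Proof.
have pair_gap (p : Lam * Lam) : exists g : R, 0 < g /\
    (p.1 != p.2 -> forall x y, X x -> X y -> g <= nrm (f p.1 x - f p.2 y)).
  case: p => i j /=; have [->|ij] := eqVneq i j; first by exists 1.
  case: X_attractor => -[x0 Xx0] Xc _.
  have XX0 : X `*` X !=set0 by exists (x0, x0).
  have C : continuous (fun p => nrm (f i p.1 - f j p.2)).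
    move=> p; apply: (@continuous_comp _ _ _
      (fun p : 'cV[R]_t * 'cV[R]_t => f i p.1 - f j p.2) nrm); last first.
      exact: is_norm_continuous.
    apply: (@cvgB _ 'cV[R]_t).
      by apply: continuous_comp; [exact: cvg_fst|exact: f_continuous].
    by apply: continuous_comp; [exact: cvg_snd|exact: f_continuous].
  have [[u v] uvX uvmin] := compact_EVT_min XX0 (compact_setX Xc Xc)
    (continuous_subspaceT C).
  move/set_mem: uvX => -[/= Xu Xv].
  exists (nrm (f i u - f j v)); split.
    apply: is_norm_gt0 => //; rewrite subr_eq0; apply/eqP => fuv.
    have : (f i @` X `&` f j @` X) (f i u).
      by split; [exists u|exists v].
    by rewrite ssc.
  move=> _ x y Xx Xy; apply: (uvmin (x, y)); exact: mem_set.
have [g gP] := choice pair_gap.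
exists (\big[Order.min/1]_p g p).
  apply/andP; split; last exact: bigmin_le_id.
  by apply: lt_bigmin => // p _; case: (gP p).
move=> i j x y ij Xx Xy; apply: (@le_trans _ _ (g (i, j))).
  exact: bigmin_le.
by case: (gP (i, j)) => _; apply.
Qed.

(** A cluster point of the images of [x0] under the prefixes of [om] lies in every closed cylinder
    that eventually contains this sequence. *)
Lemma exists_point om : exists y, codes om y.
Proof.
case: X_attractor => -[x0 Xx0] Xc _.
pose u n := word_map f (mkseq om n) x0.
have uX : (u @ \oo) X by exists 0%N => // n _; exact: word_map_sub.
have [y [_ yu]] := Xc (u @ \oo) _ uX.
exists y => n; apply: cylinder_closed => B yB.
apply: yu => //; exists n => // m /= nm.
rewrite /u -(subnKC nm) /mkseq iotaD map_cat.
apply: cylinder_cat; exact: imageP.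
Qed.

Lemma exists_code y : X y -> exists om, codes om y.
Proof.
move=> Xy.
have [[i0 _] _] := attractor_preimage Xy.
(* Outside [X] a dummy pair makes the choice of a letter and a preimage total. *)
have step x : exists p : Lam * 'cV[R]_t, X x -> X p.2 /\ x = f p.1 p.2.
  have [/attractor_preimage [p Hp]|nXx] := pselect (X x); first by exists p.
  by exists (i0, x) => /nXx.
have [F FE] := choice step.
pose z n := iter n (fun x => (F x).2) y.
have Xz n : X (z n) by elim: n => //= n IH; case: (FE _ IH).
exists (fun n => (F (z n)).1) => n; exists (z n) => //.
elim: n => [//|n IH].
rewrite mkseqS -cats1 word_map_cat /=.
by case: (FE _ (Xz n)) => _ <-.
Qed.

Lemma codes_in om y : codes om y -> X y.
Proof. by move/(_ 0%N); exact: cylinder_sub. Qed.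

(** By injectivity of the first map, one and the same [y'] serves all prefix lengths. *)
Lemma codes_shift om y : codes om y ->
  exists2 y', y = f (om 0%N) y' & codes (om \o S) y'.
Proof.
move=> c; have [y' Xy' yE] := c 1%N.
exists y' => // n; have [z Xz] := c n.+1.
rewrite mkseqS_shift -yE /= => /sim_inj <-; exact: imageP.
Qed.

Lemma codes_drop om y n : codes om y ->
  exists2 y', y = word_map f (mkseq om n) y' & codes (fun k => om (n + k)%N) y'.
Proof.
elim: n om y => [|n IH] om y c; first by exists y.
have [y1 -> /IH[y2 -> c2]] := codes_shift c.
exists y2; first by rewrite mkseqS_shift.
by move=> m; have := c2 m; congr (cylinder _ _); apply: eq_map => k /=; rewrite addSn.
Qed.

Section Gap.
Variable g : R.
Hypothesis g_itv : 0 < g <= 1.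
Hypothesis gap : forall i j x y, i != j -> X x -> X y -> g <= nrm (f i x - f j y).

Lemma gap_ratio_le w : g * wratio w <= g.
Proof. by case/andP: g_itv => g0 _; rewrite ler_piMr ?wratio_le1// ltW. Qed.

(** Induction strips the shared letters, each scaling distances by its ratio; [gap] applies at the
    first disagreement, which may come before [q] since further letters only decrease the bound. *)
Lemma codes_separated om ze y z q : codes om y -> codes ze z -> om q <> ze q ->
  g * wratio (mkseq ze q) <= nrm (y - z).
Proof.
elim: q om ze y z => [|q IH] om ze y z cy cz neq.
all: have [y' -> cy'] := codes_shift cy; have [z' -> cz'] := codes_shift cz.
  rewrite (le_trans (gap_ratio_le _))// gap//; first exact/eqP.
    exact: codes_in cy'.
  exact: codes_in cz'.
have [e|ne] := eqVneq (om 0%N) (ze 0%N); last first.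
  rewrite (le_trans (gap_ratio_le _))// gap//.
    exact: codes_in cy'.
  exact: codes_in cz'.
rewrite e f_sim mkseqS_shift wratio_cons mulrCA ler_pM2l.
  exact: IH cy' cz' neq.
by case/andP: (a_itv (ze 0%N)).
Qed.

(** The same induction for a finite word. It keeps [y] away from [f_w x] for every [w] that is not a
    prefix of the code of [y]. *)
Lemma codes_separated_word om w y z : codes om y -> X z ->
  mkseq om (size w) <> w -> g * wratio w <= nrm (y - word_map f w z).
Proof.
move=> + Xz; elim: w om y => [//|i w IH] om y c.
have [y' -> c'] := codes_shift c; rewrite [size _]/= mkseqS_shift => neq.
have [e|ne] := eqVneq (om 0%N) i; last first.
  rewrite (le_trans (gap_ratio_le _))// gap//; first exact: codes_in c'.
  exact: word_map_sub.
rewrite /= e f_sim wratio_cons mulrCA ler_pM2l; last by case/andP: (a_itv i).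
by apply: (IH (om \o S)) => //; move=> e'; apply: neq; rewrite e e'.
Qed.

End Gap.

(** * The Moran-Hutchinson formula, by coverings with cylinders *)

Section Covers.
Variable i0 : Lam.

Lemma wratio_max : exists2 M, 0 <= M < 1 & forall i, a i <= M.
Proof.
exists (\big[Order.max/0]_i a i); last by move=> i; exact: le_bigmax.
apply/andP; split; first exact: bigmax_ge_id.
by apply: bigmax_lt => // i _; case/andP: (a_itv i).
Qed.

Lemma wratio_small c : 0 < c ->
  exists N, forall w : seq Lam, (N <= size w)%N -> wratio w <= c.
Proof.
move=> c0; have [M M1 aM] := wratio_max.
have [N NP] := exp_near_le M1 c0; exists N => w Nw.
exact: le_trans (wratio_le_pow w aM) (NP _ Nw).
Qed.

Lemma wratio_powR w s : wratio w `^ s = \prod_(i <- w) a i `^ s.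
Proof.
elim: w => [|i w IH]; first by rewrite /wratio !big_nil powR1.
rewrite wratio_cons big_cons powRM ?IH//; last exact: ltW (wratio_gt0 w).
by case/andP: (a_itv i) => /ltW.
Qed.

Lemma wratio_powR_small s c : 0 < s -> 0 < c ->
  exists N, forall w : seq Lam, (N <= size w)%N -> wratio w `^ s <= c.
Proof.
move=> s0 c0; have [N NP] := wratio_small (powR_gt0 s^-1 c0).
exists N => w /NP rw; rewrite -[leRHS]powRr1 ?(ltW c0)// -(mulVf (lt0r_neq0 s0)) powRrM.
apply: (ge0_ler_powR (ltW s0)) => //.
  by rewrite nnegrE ltW ?wratio_gt0.
by rewrite nnegrE powR_ge0.
Qed.

Section GapCover.
Variable g : R.
Hypothesis g_itv : 0 < g <= 1.
Hypothesis gap : forall i j x y, i != j -> X x -> X y -> g <= nrm (f i x - f j y).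

(** If [U] meets [X] in two points, this trace lies in a smallest cylinder; two of its points have
    codes that differ by the next letter, so [gap] bounds the ratio by [diam U / g]. Otherwise a
    long word has negligible ratio, which [e] pays for. *)
Lemma cylinder_cover s (U : set 'cV[R]_t) e : 0 < s -> 0 < e ->
  exists w, U `&` X `<=` cylinder w /\
    ((wratio w `^ s)%:E <= (g `^ (- s))%:E * diam_pow nrm s U + e%:E)%E.
Proof.
move=> s0 e0; have [g0 _] := andP g_itv.
have [N NP] := wratio_powR_small s0 e0.
have small w : (N <= size w)%N ->
    ((wratio w `^ s)%:E <= (g `^ (- s))%:E * diam_pow nrm s U + e%:E)%E.
  move=> /NP rw; rewrite -[leLHS]add0e leeD ?lee_fin//.
  by rewrite mule_ge0 ?diam_pow_ge0// lee_fin powR_ge0.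
have [UX0|/set0P[z [Uz Xz]]] := eqVneq (U `&` X) set0.
  exists (nseq N i0); rewrite UX0; split; first exact: sub0set.
  by apply: small; rewrite size_nseq.
have [om omz] := exists_code Xz.
have [Qall|] := pselect (forall n, U `&` X `<=` cylinder (mkseq om n)).
  by exists (mkseq om N); split; [exact: Qall|apply: small; rewrite size_mkseq].
move/existsNP => [m0 nQm0].
have exQ : exists n, ~~ `[< U `&` X `<=` cylinder (mkseq om n) >].
  by exists m0; apply/asboolPn.
(* The shortest failing prefix is not empty, since the cylinder of the empty word is [X]; dropping
   its last letter gives the word sought. *)
case: (ex_minnP exQ) => -[|m] /asboolPn nQ minQ.
  by case: nQ; rewrite /mkseq /= => x [_ Xx]; exists x.
exists (mkseq om m); split.
  have [/asboolP//|/minQ] := boolP `[< U `&` X `<=` cylinder (mkseq om m) >].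
  by rewrite ltnn.
have [z' [[Uz' Xz'] nz']] : exists z', (U `&` X) z' /\ ~ cylinder (mkseq om m.+1) z'.
  by move/existsNP: nQ => [z' /not_implyP nz']; exists z'.
have [om' om'z'] := exists_code Xz'.
have [q qm neq] : exists2 q, (q <= m)%N & om' q <> om q.
  apply: contrapT => same; apply: nz'.
  rewrite (_ : mkseq om m.+1 = mkseq om' m.+1); first exact: om'z'.
  apply/eq_in_map => q; rewrite mem_iota add0n /= ltnS => qm.
  by apply: contrapT => /nesym ?; apply: same; exists q.
have gd : ((g * wratio (mkseq om m))%:E <= diam nrm U)%E.
  apply: le_trans (diam_ge nrm Uz' Uz); rewrite lee_fin.
  apply: le_trans (codes_separated g_itv gap om'z' omz neq).
  rewrite ler_pM2l// -(subnKC qm) /mkseq iotaD map_cat wratio_cat.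
  by rewrite ler_piMr ?wratio_le1// ltW// wratio_gt0.
rewrite -[leLHS]adde0 leeD ?lee_fin ?(ltW e0)//.
have r0 := ltW (wratio_gt0 (mkseq om m)).
have -> : wratio (mkseq om m) `^ s = g `^ (- s) * (g * wratio (mkseq om m)) `^ s.
  by rewrite (powRM _ (ltW g0) r0) mulrA powRN mulVf ?mul1r// gt_eqF ?powR_gt0.
rewrite EFinM lee_wpmul2l ?lee_fin ?powR_ge0//.
rewrite /diam_pow; case: eqP => [U0|_]; first by move: Uz; rewrite U0.
rewrite -poweR_EFin; apply: (gt0_ler_poweR (ltW s0)) => //.
  by rewrite in_itv /= lee_fin mulr_ge0 ?(ltW g0)//= leey.
by rewrite in_itv /= leey diam_ge0.
Qed.

End GapCover.

(** A cover of small total would, through [cylinder_cover], give words of total weight below 1 whose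
    cylinders cover [X], whereas [exists_avoiding] yields a code, hence a point of [X], outside all
    of them. *)
Lemma hausdorff_measure_neq0 s : 0 < s -> 1 <= \sum_i a i `^ s ->
  hausdorff_measure nrm s X <> 0%E.
Proof.
move=> s0 sum1 H0; have [g g_itv gap] := separation_gap.
have [g0 _] := andP g_itv.
(* Division by [g ^ s] leaves less than 1/4 for the diameters, and the errors of [half0] add up to
   1/2: less than 1 in all. *)
have eta0 : 0 < g `^ s / 4 by rewrite divr_gt0 ?powR_gt0.
have : (hausdorff_premeasure nrm s 1 X < (g `^ s / 4)%:E)%E.
  by rewrite (le_lt_trans (hausdorff_premeasure_le _ _ _ ltr01))// H0 lte_fin.
move=> /ereal_inf_lt[_ [U [XU _] <-] sumU].
have half0 k : 0 < 2^-1 / (2 ^ k.+1)%:R :> R.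
  by rewrite divr_gt0// ltr0n expn_gt0.
have /choice[W WP] k := cylinder_cover g_itv gap (U k) s0 (half0 k).
have D0 k : (0 <= (g `^ (- s))%:E * diam_pow nrm s (U k))%E.
  by rewrite mule_ge0 ?diam_pow_ge0// lee_fin powR_ge0.
have W1 : (\sum_(0 <= k <oo) (\prod_(i <- W k) a i `^ s)%:E < 1)%E.
  apply: (@le_lt_trans _ _ (\sum_(0 <= k <oo) ((g `^ (- s))%:E *
      diam_pow nrm s (U k) + (2^-1 / (2 ^ k.+1)%:R)%:E))%E).
    apply: lee_nneseries => [k _ _|k _]; rewrite -wratio_powR.
      by rewrite lee_fin powR_ge0.
    by case: (WP k).
  have half : 0 <= 2^-1 :> R by rewrite invr_ge0.
  apply: le_lt_trans (epsilon_trick xpredT D0 half) _.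
  rewrite nneseriesZl; last by move=> k _; exact: diam_pow_ge0.
  move: sumU; set V := (\sum_(0 <= k <oo) _)%E => sumU.
  have V0 : (0 <= V)%E by apply: nneseries_ge0 => k _ _; exact: diam_pow_ge0.
  have Vfin : V \is a fin_num by rewrite ge0_fin_numE// (lt_trans sumU)// ltry.
  move: sumU; rewrite -(fineK Vfin) -EFinM -EFinD !lte_fin powRN => Vlt.
  have gs := powR_gt0 s g0.
  have : (g `^ s)^-1 * fine V < 4^-1.
    by rewrite mulrC ltr_pdivrMr// mulrC.
  by lra.
have [om avoid] := exists_avoiding (fun i => powR_ge0 (a i) s) sum1 W1.
have [y omy] := exists_point om.
have Xy := codes_in omy; have [k _ Uky] := XU _ Xy.
case: (WP k) => /(_ y (conj Uky Xy)) [z Xz yE] _.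
have := codes_separated_word g_itv gap omy Xz (avoid _ k).
rewrite -yE subrr is_norm0// leNgt mulr_gt0//; exact: wratio_gt0.
Qed.

(** The cylinders of level [n] cover [X], and the [s]-th powers of their diameters sum to [D ^ s]
    times the [n]-th power of a number below 1. *)
Lemma hausdorff_measure_eq0 s : 0 < s -> \sum_i a i `^ s < 1 ->
  hausdorff_measure nrm s X = 0%E.
Proof.
move=> s0 sum1.
have rho0 : 0 <= \sum_i a i `^ s by apply: sumr_ge0 => i _; exact: powR_ge0.
pose D := fine (diam nrm X).
have D0 : 0 <= D by rewrite fine_ge0 ?diam_ge0.
have Ds0 := powR_ge0 D s.
suff pre0 delta e : 0 < delta -> 0 < e ->
    (hausdorff_premeasure nrm s delta X <= e%:E)%E.
  apply/eqP; rewrite eq_le; apply/andP; split.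
    apply: ge_ereal_sup => _ [delta delta0 <-]; apply/lee_addgt0Pr => e e0.
    by rewrite add0e pre0.
  apply: le_trans (hausdorff_premeasure_le _ _ _ ltr01).
  exact: hausdorff_premeasure_ge0.
move=> delta0 e0.
(* The added 1 guards against [D = 0]. *)
have c0 : 0 < delta / (D + 1) by rewrite divr_gt0//; lra.
have c'0 : 0 < e / (D `^ s + 1) by rewrite divr_gt0//; lra.
have [N1 NP1] := wratio_small c0.
have [N2 NP2] := exp_near_le (introT andP (conj rho0 sum1)) c'0.
pose n := maxn N1 N2; pose r := words Lam n.
pose U k := nth set0 (map cylinder r) k.
apply: (@le_trans _ _ (\sum_(0 <= k <oo) diam_pow nrm s (U k))%E).
  apply: ereal_inf_lbound; exists U => //; split.
    move=> x Xx; have [om omx] := exists_code Xx.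
    exists (index (mkseq om n) r) => //.
    have omr : mkseq om n \in r by have := mem_words (mkseq om n); rewrite size_mkseq.
    by rewrite /U (nth_map [::]) ?index_mem// nth_index.
  move=> k; have [kr|rk] := ltnP k (size r); last first.
    rewrite /U nth_default ?size_map//; apply: diam_le; first exact: ltW.
    by move=> ? ? [].
  rewrite /U (nth_map [::])// diam_cylinder lee_fin -/D.
  have /NP1 : (N1 <= size (nth [::] r k))%N.
    by rewrite (size_words (mem_nth _ kr)) leq_maxl.
  rewrite ler_pdivlMr; last by lra.
  apply: le_trans; rewrite ler_wpM2l ?(ltW (wratio_gt0 _))//; lra.
rewrite (nneseries_split 0 (size r)); last by move=> k _; exact: diam_pow_ge0.
rewrite add0n [X in (_ + X)%E]eseries0 ?adde0; last first.
  by move=> k rk _; rewrite /U nth_default ?size_map// diam_pow0.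
have -> : (\sum_(0 <= k < size r) diam_pow nrm s (U k) =
    \sum_(w <- r) ((D `^ s) * \prod_(i <- w) a i `^ s)%:E)%E.
  rewrite (big_nth [::]); apply: eq_big_nat => k /andP[_ kr].
  rewrite /U (nth_map [::])// /diam_pow; case: eqP => [c0'|_].
    have [x0 Xx0] : X !=set0 by case: X_attractor.
    have : cylinder (nth [::] r k) (word_map f (nth [::] r k) x0) by exists x0.
    by rewrite c0'.
  rewrite diam_cylinder poweR_EFin powRM// ?wratio_powR 1?mulrC//.
  exact: ltW (wratio_gt0 _).
rewrite sumEFin lee_fin -mulr_sumr sum_words.
have /NP2 : (N2 <= n)%N by exact: leq_maxr.
rewrite ler_pdivlMr; last by lra.
apply: le_trans; rewrite mulrC ler_wpM2l ?exprn_ge0//; lra.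
Qed.

(** The sum is continuous in the exponent. If it exceeds 1 at [d], it still does at some nearby
    exponent of zero measure, which is impossible; if it is below 1, the measure already vanishes at
    an exponent smaller than [d]. *)
Lemma sum_powR_hausdorff_dim d : 0 < d -> hausdorff_dim nrm X = d%:E ->
  \sum_i a i `^ d = 1.
Proof.
move=> d0 dimX.
have a0 i : 0 < a i by case/andP: (a_itv i).
have /cvgrPdist_lt C := continuous_sum_powR (d := d) a0.
apply/eqP; rewrite eq_le; apply/andP; split; rewrite leNgt; apply/negP => sum1.
  have /C[e /= e0 eP] : 0 < \sum_i a i `^ d - 1 by rewrite subr_gt0.
  have : (hausdorff_dim nrm X < (d + e)%:E)%E by rewrite dimX lte_fin ltrDl.
  move=> /ereal_inf_lt[_ [x [x0 Hx] <-]]; rewrite lte_fin => xde.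
  have dx : d <= x.
    by rewrite -lee_fin -dimX; apply: ereal_inf_lbound; exists x.
  have {}eP : `|\sum_i a i `^ d - \sum_i a i `^ x| < \sum_i a i `^ d - 1.
    by apply: eP; rewrite /= ler0_norm; lra.
  apply: (@hausdorff_measure_neq0 x _ _ Hx); first exact: lt_le_trans dx.
  by move: eP; rewrite ltr_norml => /andP[_ ?]; lra.
have /C[e /= e0 eP] : 0 < 1 - \sum_i a i `^ d by rewrite subr_gt0.
(* Halving puts [h] below [e], for the continuity estimate, and below [d], so that [d - h] is
   positive. *)
pose h := Order.min e d / 2.
have [he hd h0] : [/\ h < e, h < d & 0 < h].
  have : Order.min e d <= e by rewrite ge_min lexx.
  have : Order.min e d <= d by rewrite ge_min lexx orbT.
  have : 0 < Order.min e d by rewrite lt_min e0.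
  by rewrite /h; split; lra.
have {}eP : `|\sum_i a i `^ d - \sum_i a i `^ (d - h)| < 1 - \sum_i a i `^ d.
  by apply: eP; rewrite /= ger0_norm; lra.
have : hausdorff_measure nrm (d - h) X = 0%E.
  apply: hausdorff_measure_eq0; first lra.
  by move: eP; rewrite ltr_norml => /andP[? _]; lra.
move=> H0; have : (hausdorff_dim nrm X <= (d - h)%:E)%E.
  by apply: ereal_inf_lbound; exists (d - h) => //; split => //=; lra.
by rewrite dimX lee_fin; lra.
Qed.

End Covers.

(** * Divergence, choice of the block lengths, and construction of [y] *)

Lemma diam_scaledE psib w :
  diam_scaled nrm f X psib w = wratio w * fine (diam nrm X) * psib (size w).
Proof. by rewrite /diam_scaled -/(cylinder w) diam_cylinder. Qed.

(** Since the [a_i ^ d] sum to 1, the words of length [n] contribute [D ^ d * psib n ^ d] in all;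
    were this eventually below a geometric sequence, the series would converge. *)
Lemma esum_pinfty_large (d th : R) (psib : nat -> R) : 0 < d -> 0 < th < 1 ->
  \sum_i a i `^ d = 1 -> (forall n, 0 <= psib n) ->
  (\esum_(w in [set: seq Lam]) ((diam_scaled nrm f X psib w) `^ d)%:E = +oo)%E ->
  forall n0, exists2 n, (n0 <= n)%N & th ^+ n <= psib n `^ d.
Proof.
move=> d0 /andP[th0 th1] sum1 psib0 div n0; apply: contrapT => small.
have {}small n : (n0 <= n)%N -> psib n `^ d <= th ^+ n.
  by move=> n0n; rewrite leNgt; apply/negP => /ltW ?; apply: small; exists n.
pose D := fine (diam nrm X).
have D0 : 0 <= D by rewrite fine_ge0 ?diam_ge0.
pose G n := psib n `^ d.
have G0 n : 0 <= G n by exact: powR_ge0.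
(* [K] absorbs the finitely many levels below [n0], so that [G n <= K * th ^+ n] for every [n]. *)
pose K := 1 + \sum_(0 <= n < n0) G n / th ^+ n.
have thn n : 0 < th ^+ n by exact: exprn_gt0.
have q0 n : 0 <= G n / th ^+ n by rewrite divr_ge0// ltW.
have sumq0 : 0 <= \sum_(0 <= n < n0) G n / th ^+ n by apply: sumr_ge0.
have GK n : G n <= K * th ^+ n.
  have [nn0|n0n] := ltnP n n0; last first.
    rewrite (le_trans (small n n0n))// ler_peMl ?(ltW (thn n))// /K; lra.
  rewrite -ler_pdivrMr// /K (big_rem n) ?mem_index_iota//=.
  by rewrite addrCA lerDl addr_ge0// sumr_ge0.
have geo M : (1 - th) * \sum_(m <- iota 0 M) th ^+ m = 1 - th ^+ M.
  elim: M => [|M IH]; first by rewrite big_nil mulr0 expr0 subrr.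
  rewrite -addn1 iotaD big_cat /= big_seq1 add0n mulrDr IH addn1 exprS; ring.
suff : (\esum_(w in [set: seq Lam]) ((diam_scaled nrm f X psib w) `^ d)%:E
    <= (D `^ d * (K / (1 - th)))%:E)%E by rewrite div leye_eq.
apply: ge_ereal_sup => _ [F [Ffin _] <-].
rewrite fsbig_finite//= sumEFin lee_fin.
set s := finmap.enum_fset (fset_set F).
pose M := (\max_(w <- s) size w).+1.
pose T w := (diam_scaled nrm f X psib w) `^ d.
apply: (@le_trans _ _ (\sum_(w <- flatten [seq words Lam m | m <- iota 0 M]) T w)).
  apply: ler_sum_uniq_sub; first by move=> w; exact: powR_ge0.
    exact: finmap.fset_uniq.
  move=> w ws; apply/flattenP; exists (words Lam (size w)); last exact: mem_words.
  apply/mapP; exists (size w) => //.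
  by rewrite mem_iota /= add0n ltnS /M (big_rem w)//= leq_maxl.
rewrite big_flatten big_map.
have -> : \sum_(m <- iota 0 M) \sum_(w <- words Lam m) T w =
    D `^ d * \sum_(m <- iota 0 M) G m.
  rewrite mulr_sumr; apply: eq_bigr => m _.
  transitivity (\sum_(w <- words Lam m) D `^ d * G m * \prod_(i <- w) a i `^ d).
    apply: eq_big_seq => w /size_words wm.
    rewrite /T diam_scaledE -/D wm -wratio_powR.
    rewrite powRM ?mulr_ge0 ?(ltW (wratio_gt0 w))//.
    by rewrite powRM ?(ltW (wratio_gt0 w))// -/(G m); ring.
  by rewrite -mulr_sumr sum_words sum1 expr1n mulr1.
apply: ler_wpM2l; first exact: powR_ge0.
have th1' : 0 < 1 - th by lra.
rewrite ler_pdivlMr//.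
apply: (@le_trans _ _ ((K * \sum_(m <- iota 0 M) th ^+ m) * (1 - th))).
  apply: ler_wpM2r; first exact: ltW.
  by rewrite mulr_sumr; apply: ler_sum => m _.
rewrite -mulrA [X in _ * X]mulrC geo; have := thn M; rewrite /K; nra.
Qed.

(** [N = |w|] is a length at which [psib] is large, [p] pads [u] up to it, and [m] makes [a_j ^ m]
    comparable to [b ^ N]. Of the two factors [h] in the bound on [b], one is spent on [psib N] and
    the other beats the constants. *)
Lemma exists_block (j : Lam) (psi psib : nat -> R) (D C g d s b h : R) :
  0 < D -> 0 < C -> 0 < g -> 0 < s < d -> 0 < b < 1 -> 0 < h < 1 ->
  (forall n, 0 <= psib n) ->
  (exists N, forall n, (N <= n)%N -> psi n <= b ^+ n) ->
  (forall n0, exists2 n, (n0 <= n)%N & (h `^ s) ^+ n <= psib n `^ d) ->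
  b <= a j `^ (d / s - 1) * h * h ->
  forall u k, exists p m, let w := u ++ nseq p j in
    [/\ (k <= size w)%N, (0 < m)%N, D * psi (size w) <= g * (C * a j ^+ m)
      & wratio w * (C * a j ^+ m * D) < (wratio w * D * psib (size w)) `^ (d / s)].
Proof.
move=> D0 C0 g0 /andP[s0 sd] /andP[b0 b1] /andP[h0 h1] psib0 [N1 psiN] large bA u k.
set A := a j in bA *.
have A01 : 0 < A < 1 by exact: a_itv.
have /andP[A0 A1] := A01.
have kappa0 : 0 < d / s - 1 by rewrite subr_gt0 ltr_pdivlMr// mul1r.
set kappa := d / s - 1 in bA kappa0.
(* With this [K], [D * b ^+ N] equals [g * C * (K * b ^+ N)], so [K * b ^+ N] is the number to
   sandwich between powers of [A]. *)
pose K := D / (g * C).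
have K0 : 0 < K by rewrite divr_gt0// mulr_gt0.
have KE : g * C * K = D by rewrite /K; field; rewrite !gt_eqF.
have ru0 := wratio_gt0 u.
have [|N2 bN] := @exp_near_le R b (A / K) _ (divr_gt0 A0 K0).
  by rewrite ltW.
(* [B] collects the factors independent of [N] in the final comparison. *)
pose B := wratio u `^ kappa * D `^ (d / s) / (C * D * K / A).
have CDKA0 : 0 < C * D * K / A by rewrite divr_gt0 // mulr_gt0 // mulr_gt0.
have B0 : 0 < B by apply: divr_gt0 => //; apply: mulr_gt0; exact: powR_gt0.
have [|N3 hN] := @exp_near_le R h B _ B0.
  by rewrite ltW.
have [N] := large (maxn (size u) (maxn k (maxn N1 (maxn N2 N3)))).
rewrite !geq_max => /and5P[uN kN N1N N2N N3N] psibN.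
pose p := (N - size u)%N.
have pN : N = (size u + p)%N by rewrite subnKC.
have bN' : b ^+ N <= A / K by exact: bN.
have v0 : 0 < K * b ^+ N by rewrite mulr_gt0// exprn_gt0.
have vA : K * b ^+ N <= A by rewrite mulrC -ler_pdivlMr.
have [m [m0 vAm Amv]] := exp_sandwich A01 (introT andP (conj v0 vA)).
exists p, m => w; have wN : size w = N by rewrite size_cat size_nseq pN.
rewrite wN; split => //.
  have psib' : psi N <= b ^+ N by exact: psiN.
  apply: (@le_trans _ _ (D * b ^+ N)); first by rewrite ler_pM2l.
  have -> : D * b ^+ N = g * (C * (K * b ^+ N)) by rewrite -{1}KE; ring.
  by rewrite !ler_pM2l.
have r0 := wratio_gt0 w.
have rge : wratio u * A ^+ N <= wratio w.
  rewrite wratio_cat wratio_nseq ler_pM2l//; apply: ler_wiXn2l; rewrite ?(ltW A0) ?(ltW A1)//.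
  exact: leq_subr.
have ds0 : 0 < d / s by exact: divr_gt0 (lt_trans s0 sd) s0.
have psibhN : h ^+ N <= psib N `^ (d / s).
  have -> : h ^+ N = ((h `^ s) ^+ N) `^ s^-1.
    rewrite -!powR_mulrn ?powR_ge0 ?(ltW h0)// -!powRrM; congr (_ `^ _).
    by field; rewrite gt_eqF.
  rewrite powRrM; apply: ge0_ler_powR; rewrite ?nnegrE ?invr_ge0 ?powR_ge0 ?exprn_ge0//.
  - exact: ltW.
  - exact: powR_ge0.
have rkappa : wratio u `^ kappa * (A `^ kappa) ^+ N <= wratio w `^ kappa.
  have -> : wratio u `^ kappa * (A `^ kappa) ^+ N = (wratio u * A ^+ N) `^ kappa.
    rewrite powRM ?exprn_ge0 ?(ltW ru0) ?(ltW A0)//; congr (_ * _).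
    by rewrite -(powR_mulrn N (powR_ge0 A kappa)) -(powR_mulrn N (ltW A0)) powRAC.
  apply: (ge0_ler_powR (ltW kappa0)) => //; rewrite nnegrE ?(ltW r0)//.
  by rewrite mulr_ge0 ?exprn_ge0 ?(ltW A0) ?(ltW ru0).
rewrite !powRM ?mulr_ge0 ?(ltW r0) ?(ltW D0)//.
(* Writing [r ^ (d / s) = r * r ^ kappa] cancels one factor [r = wratio w]; [rkappa] bounds the
   other one from below. *)
rewrite -(mulr_powRB1 (ltW r0) ds0) -/kappa -!mulrA ltr_pM2l//.
set Ak := A `^ kappa in bA rkappa *.
have Ak0 : 0 < Ak by exact: powR_gt0.
have AkN0 : 0 < Ak ^+ N by exact: exprn_gt0.
have hN0 : 0 < h ^+ N by exact: exprn_gt0.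
have Dds : 0 < D `^ (d / s) by exact: powR_gt0.
apply: (@lt_le_trans _ _ (C * D * K / A * (Ak ^+ N * h ^+ N * h ^+ N))).
  have bNle : b ^+ N <= Ak ^+ N * h ^+ N * h ^+ N.
    rewrite -!exprMn; apply: lerXn2r => //; rewrite nnegrE ?(ltW b0)//.
    by rewrite !mulr_ge0 ?(ltW Ak0) ?(ltW h0).
  apply: (@lt_le_trans _ _ (C * D * K / A * b ^+ N)); last by rewrite ler_pM2l.
  have -> : C * D * K / A * b ^+ N = C * D * (K * b ^+ N / A) by field; rewrite gt_eqF.
  have -> : C * (A ^+ m * D) = C * D * A ^+ m by ring.
  by rewrite ltr_pM2l ?mulr_gt0// ltr_pdivlMr.
have hB : h ^+ N <= B by exact: hN.
apply: (@le_trans _ _ (wratio u `^ kappa * Ak ^+ N * (D `^ (d / s) * h ^+ N))).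
  move: hB; rewrite /B ler_pdivlMr// => hB.
  have := ler_wpM2r (mulr_ge0 (ltW AkN0) (ltW hN0)) hB.
  by congr (_ <= _); ring.
apply: ler_pM => //.
- by rewrite mulr_ge0 ?powR_ge0 ?(ltW AkN0).
- by rewrite mulr_ge0 ?powR_ge0 ?(ltW hN0).
- by rewrite ler_pM2l.
Qed.

(** The code of [y] is the limit of words [u k], each extended by a block with lengths supplied by
    [blocks]. Every block gives one approach at the scale of [psib], and its mismatches exclude the
    scale of [psi]. *)
Lemma exists_approximable (g : R) (j l : Lam) (psi psib : nat -> R)
    (e : R) (n0 : nat) (x : 'cV[R]_t) :
  let D := fine (diam nrm X) in 0 < g <= 1 ->
  (forall i j x y, i != j -> X x -> X y -> g <= nrm (f i x - f j y)) ->
  j != l -> codes (llj j l) x ->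
  (forall n, (n0 <= n)%N -> D * psi n <= g * a l) ->
  (forall u k, exists p m, let w := u ++ nseq p j in
    [/\ (k <= size w)%N, (0 < m)%N,
        D * psi (size w) <= g * (a l ^+ 2 * a j ^+ m)
      & wratio w * (a l ^+ 2 * a j ^+ m * D) <
          (wratio w * D * psib (size w)) `^ e]) ->
  exists y, [/\ X y,
    forall w, (n0 <= size w)%N ->
      wratio w * D * psi (size w) <= nrm (y - word_map f w x)
    & forall k, exists2 w, nrm (y - word_map f w x) <
        (wratio w * D * psib (size w)) `^ e & (k <= size w)%N].
Proof.
move=> D g_itv gap jl xcode psi_small blocks.
have [g0 _] := andP g_itv; have Xx := codes_in xcode.
have [al0 al1] := andP (a_itv l).
pose good u k (pm : nat * nat) := let w := u ++ nseq pm.1 j in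
  [/\ (k <= size w)%N, (0 < pm.2)%N,
      D * psi (size w) <= g * (a l ^+ 2 * a j ^+ pm.2)
    & wratio w * (a l ^+ 2 * a j ^+ pm.2 * D) <
        (wratio w * D * psib (size w)) `^ e].
have /choice[F FP] (uk : seq Lam * nat) : exists pm, good uk.1 uk.2 pm.
  by have [p [m H]] := blocks uk.1 uk.2; exists (p, m).
have {F FP}[pm pmP] : exists pm, forall u k, good u k (pm u k).
  by exists (fun u k => F (u, k)) => u k; exact: (FP (u, k)).
have [u u0 uS] : exists2 u : nat -> seq Lam, u 0%N = [::] & forall k,
    u k.+1 = u k ++ block j l (pm (u k) k).1 (pm (u k) k).2.
  by exists (fix u k := if k is k'.+1
    then u k' ++ block j l (pm (u k') k').1 (pm (u k') k').2 else [::]).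
have usize k : (k <= size (u k))%N.
  by elim: k => // k IH; rewrite uS size_cat size_block; lia.
have chain k : exists v, u k.+1 = u k ++ v.
  by exists (block j l (pm (u k) k).1 (pm (u k) k).2).
have uE := nth_prefix_chain j chain usize.
pose om n := nth j (u n.+1) n.
(* From any position [n >= n0] the code of [y] leaves [llj] early enough for the separation bound to
   reach [D * psi n]. Positions in [u k] are settled by induction, as later blocks leave them
   unchanged. *)
have mismatch k n : (n0 <= n)%N -> (n < size (u k))%N ->
    exists q, [/\ (n + q < size (u k))%N, nth j (u k) (n + q) <> llj j l q
      & D * psi n <= g * wratio (mkseq (llj j l) q)].
  move=> n0n; elim: k => [|k IH]; first by rewrite u0.
  have [/IH[q [nq neq psiq]] _|un] := ltnP n (size (u k)).
    exists q; split => //; first by rewrite uS size_cat ltn_addr.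
    by rewrite uS nth_cat nq.
  have [/= _ m0 psim _] := pmP (u k) k.
  move: (pm (u k) k) (uS k) m0 psim => [p m] /= -> m0 psim.
  rewrite size_cat size_block => nu.
  have [|q [iq neq q1]] := @block_mismatch _ j l p m (n - size (u k)) jl m0.
    by rewrite ltn_subLR.
  have nqE : (n + q = size (u k) + (n - size (u k) + q))%N.
    by rewrite addnA subnKC.
  exists q; split; rewrite ?nqE ?ltn_add2l//.
    by rewrite nth_cat ltnNge leq_addr /= addKn.
  (* A match of at most one letter is covered by [psi_small]; a longer one starts at the end of
     [u k ++ nseq p j], the word for which [m] was chosen. *)
  case: q1 => [q1|[np ->]].
    apply: le_trans (psi_small n n0n) _; rewrite ler_pM2l//.
    case: q q1 {iq neq nqE} => [|[|]]// _.
      by rewrite /wratio big_nil ltW.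
    by rewrite /wratio big_seq1.
  rewrite mkseq_llj !wratio_cons wratio_nseq (mulrA (a l)) -expr2.
  suff -> : n = size (u k ++ nseq p j) by [].
  by rewrite size_cat size_nseq -np subnKC.
have [y ycode] := exists_point om.
exists y; split.
- exact: codes_in ycode.
- move=> w nw; have rw := wratio_gt0 w.
  have [omw|omw] := eqVneq (mkseq om (size w)) w; last first.
    move/eqP: omw => omw; apply: le_trans (codes_separated_word g_itv gap ycode Xx omw).
    rewrite -mulrA mulrC ler_pM2r//; apply: le_trans (psi_small _ nw) _.
    by rewrite ler_piMr// ltW.
  (* Position [size w] lies inside [u (size w).+1], which has at least [(size w).+1] letters. *)
  have [q [nq neq psiq]] := mismatch (size w).+1 (size w) nw (usize _).
  have [y' -> y'code] := codes_drop (size w) ycode.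
  rewrite omw word_map_sim -mulrA ler_pM2l//; apply: le_trans psiq _.
  apply: (codes_separated g_itv gap y'code xcode).
  by rewrite -(nth_mkseq j om nq) uE.
- move=> k; have [/= kw m0 _ close] := pmP (u k) k.
  move: (pm (u k) k) (uS k) kw m0 close => [p m] /= uk kw m0 close.
  (* After this [w], the codes of [y] and of [f_w x] still share [l l j^m], which bounds their
     distance. *)
  exists (u k ++ nseq p j) => //; apply: le_lt_trans close.
  have := ycode (size (u k.+1)); rewrite uE uk.
  have -> : u k ++ block j l p m =
      (u k ++ nseq p j) ++ (l :: l :: nseq m j) ++ [:: l; j].
    by rewrite -catA.
  move=> [z Xz <-]; rewrite (word_map_cat (u k ++ _)) word_map_sim.
  rewrite ler_pM2l ?wratio_gt0//.
  have := xcode m.+2; rewrite mkseq_llj => -[z' Xz' <-].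
  rewrite (word_map_cat (l :: _)) word_map_sim !wratio_cons wratio_nseq.
  rewrite (mulrA (a l)) -expr2 ler_pM2l ?mulr_gt0 ?exprn_gt0//; last by case/andP: (a_itv j).
  by rewrite -lee_fin -diam_attractor_fin; apply: diam_ge => //; exact: word_map_sub.
Qed.

End SelfSimilar.

(** * Choice of the constants and conclusion *)

Theorem proposition3p3 (R : realType) (t : nat)
    (nrm : 'cV[R]_t -> R) (nrm_norm : is_norm nrm)
    (Lam : finType) (a : Lam -> R) (O : Lam -> 'M[R]_t) (b : Lam -> 'cV[R]_t)
    (a_itv : forall i, 0 < a i < 1)
    (O_rot : forall i, is_rotation (O i))
    (O_conf : forall i y, nrm (O i *m y) = nrm y)
    (X : set 'cV[R]_t) (X_attractor : is_attractor (ifs_map a O b) X)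
    (ssc : strong_separation (ifs_map a O b) X)
    (d : R) (d_dim : hausdorff_dim nrm X = d%:E)
    (a_neq : exists i j : Lam, a i <> a j)
    (psi : nat -> R) (psi_ge0 : forall n, 0 <= psi n)
    (psi_decr : forall m n, (m <= n)%N -> psi n <= psi m)
    (alpha : R) (alpha_lim : decay_rate psi n @[n --> \oo] --> alpha%:E)
    (alpha_gt0 : 0 < alpha) (alpha_lt : alpha < d)
    (s : R) (s_eq : \sum_(i : Lam) expR (- (alpha * s)) * (a i `^ s) = 1)
    (Psi_div : (\esum_(w in [set: seq Lam])
      ((diam_scaled nrm (ifs_map a O b) X psi w) `^ s)%:E = +oo)%E) :
  exists x : 'cV[R]_t, X x /\
    ~ exists psib : nat -> R,
      (forall n, 0 <= psib n) /\
      [/\ (0 <= limn_einf (decay_rate psib))%E,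
          (\esum_(w in [set: seq Lam])
            ((diam_scaled nrm (ifs_map a O b) X psib w) `^ d)%:E = +oo)%E
        & limsup_set nrm (ifs_map a O b) X x
            (fun w => (diam_scaled nrm (ifs_map a O b) X psib w) `^ (d / s))
          `<=` limsup_set nrm (ifs_map a O b) X x
            (diam_scaled nrm (ifs_map a O b) X psi)].
Proof.
set f := ifs_map a O b in X_attractor ssc Psi_div *.
have f_continuous i : continuous (f i) by exact: continuous_affine_mx.
have f_sim i x y : nrm (f i x - f i y) = a i * nrm (x - y).
  rewrite /f /ifs_map opprD addrACA subrr addr0 -scalerBr -mulmxBr.
  case: nrm_norm => _ nrmZ _; rewrite nrmZ O_conf gtr0_norm//.
  by case/andP: (a_itv i).
have [i1 [i2 ai12]] := a_neq.
have d0 : 0 < d by exact: lt_trans alpha_lt.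
have sum1 : \sum_i a i `^ d = 1.
  exact: (sum_powR_hausdorff_dim nrm_norm a_itv f_continuous f_sim X_attractor ssc i1).
have [/andP[s0 sd] [j aj]] :=
  exists_frequency_gap a_itv a_neq alpha_gt0 sum1 s_eq.
have [l jl] : exists l, j != l.
  have [ji1|?] := eqVneq j i1; last by exists i1.
  by exists i2; apply/eqP => ji2; apply: ai12; rewrite -ji1 -ji2.
have [al0 al1] := andP (a_itv l).
have [aj0 aj1] := andP (a_itv j).
have [g g_itv gap] :=
  separation_gap nrm_norm f_continuous X_attractor ssc.
have [g0 _] := andP g_itv.
pose D := fine (diam nrm X).
(* Two points of [X] in different first-level pieces are at distance at least [g]. *)
have D0 : 0 < D.
  have [[x0 Xx0] _ _] := X_attractor.
  apply: lt_le_trans g0 _; apply: le_trans (gap _ _ _ _ jl Xx0 Xx0) _.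
  rewrite -lee_fin -(diam_attractor_fin nrm_norm X_attractor).
  by apply: diam_ge; exact: attractor_sub.
(* [x] depends only on [j] and [l], hence is fixed before [psib] is given. *)
have [x xcode] := exists_point f_continuous X_attractor (llj j l).
have Xx := codes_in X_attractor xcode.
exists x; split => // -[psib [psib_ge0 [_ psib_div sub]]].
pose kappa := d / s - 1.
have kappa0 : 0 < kappa by rewrite subr_gt0 ltr_pdivlMr// mul1r.
pose gam := - (kappa * ln (a j)).
have ajE : a j `^ kappa = expR (- gam) by rewrite opprK /powR gt_eqF.
have gam0 : 0 < gam by rewrite oppr_gt0 pmulr_rlt0// ln_lt0// aj0.
have gam_alpha : gam < alpha by move: aj; rewrite ajE ltr_expR ltrN2.
(* Since [alpha - eps = gam + 2 eps], the base [exp (- (alpha - eps))] that bounds the decay of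
   [psi] equals [a_j ^ kappa * h * h]. *)
pose eps := (alpha - gam) / 3.
have eps0 : 0 < eps by rewrite /eps; lra.
pose h := expR (- eps).
have h_itv : 0 < h < 1 by rewrite expR_gt0 -expR0 ltr_expR oppr_lt0 eps0.
have [beta_alpha beta0] : alpha - eps < alpha /\ 0 < alpha - eps.
  by rewrite /eps; split; lra.
have b_itv : 0 < expR (- (alpha - eps)) < 1.
  by rewrite expR_gt0 -expR0 ltr_expR oppr_lt0 beta0.
have [N1 psiN1] := decay_rate_gt psi_ge0 alpha_lim beta_alpha.
(* Together with [psiN1] this gives [D * psi n <= g * a l] for large [n], which handles matches of
   at most one letter. *)
have [N2 bN2] : exists N, forall n, (N <= n)%N ->
    expR (- (alpha - eps)) ^+ n <= g * a l / D.
  by apply: exp_near_le; [rewrite expR_ge0; case/andP: b_itv|rewrite divr_gt0 ?mulr_gt0].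
have hs_itv : 0 < h `^ s < 1.
  rewrite -expRM expR_gt0 -expR0 ltr_expR mulNr oppr_lt0; exact: mulr_gt0.
have [y [Xy far close]] : exists y, [/\ X y,
    forall w, (maxn N1 N2 <= size w)%N ->
      wratio a w * D * psi (size w) <= nrm (y - word_map f w x)
    & forall k, exists2 w, nrm (y - word_map f w x) <
        (wratio a w * D * psib (size w)) `^ (d / s) & (k <= size w)%N].
  apply: (exists_approximable nrm_norm a_itv f_continuous f_sim X_attractor
    g_itv gap jl xcode).
    move=> n; rewrite geq_max => /andP[/psiN1 psin /bN2].
    rewrite ler_pdivlMr// => bn; apply: le_trans bn.
    by rewrite mulrC ler_pM2r.
  apply: (@exists_block _ _ a a_itv j psi psib D (a l ^+ 2) g d s
    (expR (- (alpha - eps))) h) => //.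
  - exact: exprn_gt0.
  - by rewrite s0.
  - by exists N1.
  - exact: (esum_pinfty_large nrm_norm a_itv f_sim X_attractor d0 hs_itv sum1).
  - by rewrite -/kappa ajE -!expRD ler_expR /eps; lra.
have Wy : limsup_set nrm f X x (fun w => diam_scaled nrm f X psib w `^ (d / s)) y.
  split=> //; apply: infinite_words => k; have [w wy kw] := close k.
  exists w => //=; by rewrite (diam_scaledE nrm_norm a_itv f_sim X_attractor).
have [_] := sub y Wy; apply.
(* Only words shorter than [maxn N1 N2] can bring [y] within the radius given by [psi]. *)
apply: sub_finite_set (finite_words_lt Lam (maxn N1 N2)) => w /=.
rewrite (diam_scaledE nrm_norm a_itv f_sim X_attractor) ltnNge => wy.
by apply/negP => /far; rewrite leNgt wy.
Qed.
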